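(* Let $r\in(0,\infty)$ and let $u\in\operatorname{dom}\Delta_r$. Then the normal derivative $\partial_{n,r}u(x)$ exists for every $x\in V_0$, and the Gauss-Green formula $$\mathcal{E}_r(u,v)=-\int_{SG}(\Delta_r u)\,v\,d\mu_r+\sum_{x\in V_0}v(x)\,\partial_{n,r}u(x)$$ holds for all $v\in\operatorname{dom}\mathcal{E}_r$.
   Context: Let $q_0,q_1,q_2$ be the vertices of a triangle in the plane, $F_i(x)=\tfrac12(x-q_i)+q_i$, and $F_{ij}=F_i\circ F_j$ for $i,j\in\{0,1,2\}$; indices of the $q_i$ are cyclic mod 3. The Sierpinski gasket $SG$ is the unique nonempty compact set with $SG=\bigcup_{i,j}F_{ij}SG$. Put $V_0=\{q_0,q_1,q_2\}$ (the boundary), $V_{m+1}=\bigcup_{i,j}F_{ij}V_m$, $V_*=\bigcup_m V_m$. A word of length $|w|=m$ is $w=(w_1,\dots,w_m)$ with each $w_k\in\{ij: i,j\in\{0,1,2\}\}$, and $F_w=F_{w_1}\circ\dots\circ F_{w_m}$; $F_wSG$ is a cell of level $m$. The graph $\Gamma_m$ has vertex set $V_m$ and an edge $x\sim_m y$ when $x=F_wq_j$, $y=F_wq_k$ for some $|w|=m$, $j\ne k$. Fix $r\in(0,\infty)$ and set $D(r)=9r^2+26r+15$, $r_0(r)=\frac{6r(r+2)}{D(r)}$, $r_1(r)=\frac{6(r+2)}{D(r)}$, $\mu_0(r)=\frac1{3(2r+1)}$, $\mu_1(r)=\frac r{3(2r+1)}$. Resistances: $\mathrm{res}_0(x,y)=1$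 on edges of $\Gamma_0$, and $\mathrm{res}_{m+1}(F_{ij}x,F_{ij}y)=r_0(r)\,\mathrm{res}_m(x,y)$ if $i=j$, $=r_1(r)\,\mathrm{res}_m(x,y)$ if $i\neq j$. Energy: $\mathcal{E}_{r,m}(u,v)=\sum_{x\sim_m y}\mathrm{res}_m(x,y)^{-1}(u(x)-u(y))(v(x)-v(y))$ (each edge counted once), $\mathcal{E}_r(u,v)=\lim_{m\to\infty}\mathcal{E}_{r,m}(u,v)$, $\mathcal E_r(u)=\mathcal E_r(u,u)$; $\operatorname{dom}\mathcal{E}_r$ is the set of (continuous) functions $u$ on $SG$ with $\mathcal{E}_r(u)<\infty$. Measure: $\mu_r$ is the self-similar Borel probability measure on $SG$ with $\mu_r(F_{ij}A)=\mu_0(r)\mu_r(A)$ if $i=j$ and $=\mu_1(r)\mu_r(A)$ if $i\ne j$. Laplacian: $u\in\operatorname{dom}\Delta_r$ with $\Delta_ru=f$ means that $u\in\operatorname{dom}\mathcal{E}_r$, $f$ is continuous on $SG$, and $-\mathcal{E}_r(u,v)=\int_{SG}vf\,d\mu_r$ for all $v\in\operatorname{dom}\mathcal{E}_r$ vanishing on $V_0$. Normal derivative: with $\lambda_{\mathrm{sym}}(r)=r_0(r)=\frac{6r(r+2)}{D(r)}$, $$\partial_{n,r}u(q_i)=\lim_{m\to\infty}\lambda_{\mathrm{sym}}(r)^{-m}\bigl(2u(q_i)-u(F_{ii}^mq_{i+1})-u(F_{ii}^mq_{i-1})\bigr).$$ *)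

(* Defs.v *)
From HB Require Import structures.
From mathcomp Require Import all_boot all_order all_algebra.
From mathcomp Require Import all_classical all_reals all_analysis.

Set Implicit Arguments.
Unset Strict Implicit.
Unset Printing Implicit Defensive.

Import Order.TTheory GRing.Theory Num.Theory.
Import numFieldNormedType.Exports.

Local Open Scope classical_set_scope.
Local Open Scope ring_scope.

Notation plane R := (R * R)%type.

Notation borelPlane R := (g_sigma_algebraType (@open (plane R))).

(* The determinant is twice the signed area. *)
Definition is_triangle (R : realType) (q : 'I_3 -> plane R) : Prop :=
  ((q 1).1 - (q 0).1) * ((q 2%:R).2 - (q 0).2)
  - ((q 1).2 - (q 0).2) * ((q 2%:R).1 - (q 0).1) != 0.

Definition Fmap (R : realType) (q : 'I_3 -> plane R) (i : 'I_3)
  (x : plane R) : plane R := (2^-1 : R) *: (x - q i) + q i.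

Definition F2 (R : realType) (q : 'I_3 -> plane R) (i j : 'I_3) :
  plane R -> plane R := Fmap q i \o Fmap q j.

Definition Fword (R : realType) (q : 'I_3 -> plane R)
  (w : seq ('I_3 * 'I_3)) (x : plane R) : plane R :=
  foldr (fun a y => F2 q a.1 a.2 y) x w.

Definition is_gasket (R : realType) (q : 'I_3 -> plane R)
  (SG : set (plane R)) : Prop :=
  [/\ SG !=set0, compact SG &
      SG = \bigcup_(a in [set: 'I_3 * 'I_3]) (F2 q a.1 a.2 @` SG)].

Definition Dr (R : realType) (r : R) : R := 9 * r ^+ 2 + 26 * r + 15.
Definition r0 (R : realType) (r : R) : R := 6 * r * (r + 2) / Dr r.
Definition r1 (R : realType) (r : R) : R := 6 * (r + 2) / Dr r.
Definition mu0 (R : realType) (r : R) : R := (3 * (2 * r + 1))^-1.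
Definition mu1 (R : realType) (r : R) : R := r / (3 * (2 * r + 1)).

Definition edge (R : realType) (q : 'I_3 -> plane R) (m : nat)
  (x y : plane R) : Prop :=
  exists w : seq ('I_3 * 'I_3), exists j k : 'I_3,
    [/\ size w = m, j != k, x = Fword q w (q j) & y = Fword q w (q k)].

(* An edge of the (m+1)-st graph is the image under exactly one F_ij of an edge
   of the m-th graph, so the set below is a singleton. Off the edges the value
   is irrelevant. *)
Fixpoint res (R : realType) (q : 'I_3 -> plane R) (r : R) (m : nat)
  (x y : plane R) : R :=
  if m is n.+1 then
    xget 0 [set rho : R | exists i j : 'I_3, exists x' y' : plane R,
      [/\ edge q n x' y', x = F2 q i j x', y = F2 q i j y' &
          rho = (if i == j then r0 r else r1 r) * res q r n x' y']]
  else 1.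

(* Each edge occurs in the sum in both orientations, hence the factor 1/2. *)
Definition graph_energy (R : realType) (q : 'I_3 -> plane R) (r : R) (m : nat)
  (u v : plane R -> R) : R :=
  2^-1 * \sum_(e \in [set e : plane R * plane R | edge q m e.1 e.2])
           (res q r m e.1 e.2)^-1 * (u e.1 - u e.2) * (v e.1 - v e.2).

Definition energy (R : realType) (q : 'I_3 -> plane R) (r : R)
  (u v : plane R -> R) : \bar R :=
  limn (fun m => (graph_energy q r m u v)%:E).

(* Functions on SG are represented by functions on the plane, of which only the
   values on SG matter. *)
Definition dom_energy (R : realType) (q : 'I_3 -> plane R)
  (SG : set (plane R)) (r : R) (u : plane R -> R) : Prop :=
  {within SG, continuous u} /\ (energy q r u u < +oo)%E.

Definition is_self_similar_measure (R : realType) (q : 'I_3 -> plane R)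
  (SG : set (plane R)) (r : R) (mu : probability (borelPlane R) R) : Prop :=
  mu SG = 1%E /\
  forall (i j : 'I_3) (A : set (borelPlane R)),
    measurable A -> A `<=` SG ->
    mu (F2 q i j @` A) = ((if i == j then mu0 r else mu1 r)%:E * mu A)%E.

(* [is_laplacian q SG r mu u f]: u belongs to the domain of the Laplacian, and
   its Laplacian is f. *)
Definition is_laplacian (R : realType) (q : 'I_3 -> plane R)
  (SG : set (plane R)) (r : R) (mu : probability (borelPlane R) R)
  (u f : plane R -> R) : Prop :=
  [/\ dom_energy q SG r u, {within SG, continuous f} &
      forall v : plane R -> R, dom_energy q SG r v ->
        (forall i, v (q i) = 0) ->
        (- energy q r u v = \int[mu]_(x in SG) (v x * f x)%:E)%E].

Definition lambda_sym (R : realType) (r : R) : R := r0 r.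

(* Indices are added in 'I_3, that is, modulo 3. *)
Definition normal_diff (R : realType) (q : 'I_3 -> plane R) (r : R)
  (u : plane R -> R) (i : 'I_3) (m : nat) : R :=
  lambda_sym r ^- m *
    (2 * u (q i) - u (iter m (F2 q i i) (q (i + 1)))
                 - u (iter m (F2 q i i) (q (i - 1)))).

Definition normal_derivative (R : realType) (q : 'I_3 -> plane R) (r : R)
  (u : plane R -> R) (i : 'I_3) : R := limn (normal_diff q r u i).

(* Main.v *)
(* The paper's renormalization factors make the energies of the graphs
   compatible: with respect to the energy of level one, a function on V_1 that
   solves the Kirchhoff equations inside is orthogonal to everything in the sense
   that E_1(u, h) = E_0(u, h) for all u. Hence the graph energies increase with
   the level, their limit is a quadratic form on a vector space, and harmonic
   functions, obtained by iterating the level-one extension, satisfy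
   E(u, h) = E_0(u, h) and are continuous because the extension contracts
   oscillations by a fixed factor.

   Let psi_m be 1 at q_i, 0 at the other vertices of F_ii^m SG, harmonic on that
   cell and 0 off it. By self-similarity E(u, psi_m) is the m-th difference
   quotient of the normal derivative at q_i. By the definition of the Laplacian,
   N(v) = E(u, v) + int (Lap u) v vanishes when v vanishes on V_0, so N(v) depends
   only on v|V_0 and N(psi_m) = N(psi_0) for all m. As int (Lap u) psi_m is
   O(mu_0^m), the quotients converge to N(psi_0), and expanding N(v) over the
   three boundary values is the Gauss-Green formula. *)
Require Import Defs.
From HB Require Import structures.
From mathcomp Require Import all_boot all_order all_algebra.
From mathcomp Require Import all_classical all_reals all_analysis.
From mathcomp Require Import ring lra.
Import Order.TTheory GRing.Theory Num.Theory.
Import numFieldNormedType.Exports.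
Local Open Scope classical_set_scope.
Local Open Scope ring_scope.

Set Implicit Arguments.
Unset Strict Implicit.
Unset Printing Implicit Defensive.

(** * Barycentric coordinates and the gasket *)

Lemma ord3P (i : 'I_3) : [\/ i = 0, i = 1 | i = 2%:R].
Proof.
case: i => -[|[|[|//]]] h; [apply: Or31|apply: Or32|apply: Or33]; exact/val_inj.
Qed.

Lemma big_ord3 (V : nmodType) (f : 'I_3 -> V) : \sum_i f i = f 0 + f 1 + f 2%:R.
Proof.
rewrite !big_ord_recl big_ord0 addr0 addrA.
by congr (_ + _ + _); congr f; exact/val_inj.
Qed.

Lemma ord3D :
  (((0 + 1)%R = 1%R :> 'I_3) * ((1 + 1)%R = 2%:R :> 'I_3) *
   ((2%:R + 1)%R = 0%R :> 'I_3) * ((0 - 1)%R = 2%:R :> 'I_3) *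
   ((1 - 1)%R = 0%R :> 'I_3) * ((2%:R - 1)%R = 1%R :> 'I_3) *
   ((0 + 2%:R)%R = 2%:R :> 'I_3) * ((1 + 2%:R)%R = 0%R :> 'I_3) *
   ((2%:R + 2%:R)%R = 1%R :> 'I_3))%type.
Proof. by do !split; exact/val_inj. Qed.

Lemma ord3E :
  (((0 == 1 :> 'I_3) = false) * ((1 == 0 :> 'I_3) = false) *
   ((0 == 2%:R :> 'I_3) = false) * ((2%:R == 0 :> 'I_3) = false) *
   ((1 == 2%:R :> 'I_3) = false) * ((2%:R == 1 :> 'I_3) = false))%type.
Proof. by []. Qed.

Section Barycentric.
Context (R : realType) (q : 'I_3 -> plane R) (hq : is_triangle q).
Implicit Types (x y : plane R) (i j k : 'I_3).

Let area x y z : R :=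
  (y.1 - x.1) * (z.2 - x.2) - (y.2 - x.2) * (z.1 - x.1).

Definition bary i x : R :=
  area x (q (i + 1)) (q (i + 2%:R)) / area (q 0) (q 1) (q 2%:R).

Let area0 : area (q 0) (q 1) (q 2%:R) != 0. Proof. exact: hq. Qed.

Lemma bary_vertex i j : bary i (q j) = (i == j)%:R.
Proof.
move: area0; rewrite /bary /area.
by case: (ord3P i) => ->; case: (ord3P j) => ->;
  rewrite ?ord3D ?ord3E ?eqxx /= => h; field.
Qed.

Lemma vertex_inj : injective q.
Proof.
move=> i j /(congr1 (bary i)); rewrite !bary_vertex eqxx.
by case: eqP => // _ /eqP; rewrite oner_eq0.
Qed.

Lemma bary_sum x : bary 0 x + bary 1 x + bary 2%:R x = 1.
Proof. by move: area0; rewrite /bary /area !ord3D => h; field. Qed.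

Lemma bary_Fmap i j x : bary i (Fmap q j x) = (bary i x + (i == j)%:R) / 2.
Proof.
have e1 : (Fmap q j x).1 = 2^-1 * (x.1 - (q j).1) + (q j).1 by [].
have e2 : (Fmap q j x).2 = 2^-1 * (x.2 - (q j).2) + (q j).2 by [].
rewrite -bary_vertex /bary /area e1 e2; move: area0; rewrite /area.
by case: (ord3P i) => ->; case: (ord3P j) => ->;
  rewrite ?ord3D ?ord3E ?eqxx /= => h; field.
Qed.

Lemma bary_F2 i j k x :
  bary k (F2 q i j x) = bary k x / 4 + (k == j)%:R / 4 + (k == i)%:R / 2.
Proof. by rewrite /F2 /= !bary_Fmap; field. Qed.

Lemma bary_inj x y : (forall i, bary i x = bary i y) -> x = y.
Proof.
have E z : z = (bary 0 z * (q 0).1 + bary 1 z * (q 1).1 + bary 2%:R z * (q 2%:R).1,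
                bary 0 z * (q 0).2 + bary 1 z * (q 1).2 + bary 2%:R z * (q 2%:R).2).
  move: area0; rewrite /bary /area !ord3D; case: z => a b /= h.
  by congr pair; field.
by move=> h; rewrite (E x) (E y) !h.
Qed.

Lemma continuous_bary i : continuous (bary i).
Proof.
move=> x; rewrite /bary /area; apply: cvgM; last exact: cvg_cst.
have c1 : (fun y : plane R => y.1) @ x --> x.1 by exact: cvg_fst.
have c2 : (fun y : plane R => y.2) @ x --> x.2 by exact: cvg_snd.
by apply: cvgB; apply: cvgM; apply: cvgB => //; exact: cvg_cst.
Qed.

Lemma Fmap_inj i : injective (Fmap q i).
Proof.
move=> x y e; apply: bary_inj => k.
by have := congr1 (bary k) e; rewrite !bary_Fmap; lra.
Qed.

Lemma F2_inj i j : injective (F2 q i j).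
Proof. by move=> x y /Fmap_inj /Fmap_inj. Qed.

Lemma Fmap_vertexC i j : Fmap q i (q j) = Fmap q j (q i).
Proof.
apply: bary_inj => k; rewrite !bary_Fmap !bary_vertex; congr (_ / _).
exact: addrC.
Qed.

Lemma Fmap_vertex i : Fmap q i (q i) = q i.
Proof. by rewrite /Fmap subrr scaler0 add0r. Qed.

Lemma F2_vertex i : F2 q i i (q i) = q i.
Proof. by rewrite /F2 /= !Fmap_vertex. Qed.

Lemma F2_vertexC i j k : F2 q i j (q k) = F2 q i k (q j).
Proof. by rewrite /F2 /= Fmap_vertexC. Qed.

Lemma F2_midC i j : F2 q i j (q j) = F2 q j i (q i).
Proof. by rewrite /F2 /= !Fmap_vertex Fmap_vertexC. Qed.

Definition triangle : set (plane R) := [set x | forall i, 0 <= bary i x].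

Lemma triangle_vertex i : triangle (q i).
Proof. by move=> k; rewrite bary_vertex. Qed.

Lemma triangle_F2 i j x : triangle x -> triangle (F2 q i j x).
Proof.
move=> tx k; rewrite bary_F2; apply: addr_ge0; last by rewrite divr_ge0.
by rewrite addr_ge0// divr_ge0.
Qed.

Lemma triangle_Fmap i x : triangle x -> triangle (Fmap q i x).
Proof. by move=> tx k; rewrite bary_Fmap divr_ge0// addr_ge0. Qed.

(** On the image of the triangle under [Fmap q i] the [i]-th coordinate is at least 1/2. As the
    coordinates sum to 1, a common point of two images is the midpoint of [q i] and [q j]. *)
Lemma Fmap_meet i j x y : triangle x -> triangle y -> i != j ->
  Fmap q i x = Fmap q j y -> x = q j.
Proof.
move=> tx ty ij e; apply: bary_inj => k.
have := congr1 (bary 0) e; have := congr1 (bary 1) e.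
have := congr1 (bary 2%:R) e; rewrite !bary_Fmap bary_vertex.
have := bary_sum x; have := bary_sum y.
have := tx 0; have := tx 1; have := tx 2%:R.
have := ty 0; have := ty 1; have := ty 2%:R.
case: (ord3P i) ij => ->; case: (ord3P j) => ->; rewrite ?eqxx ?ord3E //= => _;
  case: (ord3P k) => ->; rewrite ?eqxx ?ord3E /=; lra.
Qed.

Lemma Fmap_eq_vertex i j x : triangle x -> Fmap q i x = q j -> i = j /\ x = q j.
Proof.
move=> tx e; have [ij|/eqP ij] := eqVneq i j.
  by split=> //; subst j; move: e; rewrite -[RHS](Fmap_vertex i) => /Fmap_inj.
exfalso.
have := congr1 (bary 0) e; have := congr1 (bary 1) e.
have := congr1 (bary 2%:R) e; rewrite !bary_Fmap !bary_vertex.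
have := bary_sum x.
have := tx 0; have := tx 1; have := tx 2%:R.
case: (ord3P i) ij => ->; case: (ord3P j) => ->; rewrite ?eqxx ?ord3E //= => _; lra.
Qed.

(** The second case is two subcells of one image [Fmap q i]. In the third the outer images differ
    and touch only at the midpoint of [q i] and [q i'], which lies in a single subcell on each side;
    this forces [j] and [j']. *)
Lemma F2_meet i j i' j' x y : triangle x -> triangle y ->
  F2 q i j x = F2 q i' j' y ->
  [\/ [/\ i = i', j = j' & x = y],
      [/\ i = i', j != j', x = q j' & y = q j] |
      [/\ i != i', i' = j, j' = i, x = q j & y = q i]].
Proof.
move=> tx ty; rewrite /F2 /=; have [<-{i'}|ii] := eqVneq i i'.
  move=> /Fmap_inj; have [<- /Fmap_inj|jj e] := eqVneq j j'.
    by move=> ->; apply: Or31.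
  apply: Or32; split=> //; first exact: Fmap_meet e.
  by rewrite eq_sym in jj; exact: (Fmap_meet ty tx jj).
move=> e; apply: Or33.
have /(Fmap_eq_vertex tx) [-> ->] : Fmap q j x = q i'.
  by apply: Fmap_meet e => //; exact: triangle_Fmap.
rewrite eq_sym in ii.
have /(Fmap_eq_vertex ty) [-> ->] : Fmap q j' y = q i.
  by apply: (Fmap_meet _ _ ii (esym e)); exact: triangle_Fmap.
by split=> //; rewrite eq_sym.
Qed.

End Barycentric.

(** * The gasket as a closed subset of the triangle, and its cells *)

Section Gasket.
Context (R : realType) (q : 'I_3 -> plane R) (SG : set (plane R)).
Hypotheses (hq : is_triangle q) (hSG : is_gasket q SG).
Implicit Types (x y : plane R) (i j k : 'I_3).

Lemma gasket_F2 i j x : SG x -> SG (F2 q i j x).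
Proof. by case: hSG => _ _ {2}-> sx; exists (i, j) => //; exists x. Qed.

Lemma gasket_decomp x : SG x -> exists p : ('I_3 * 'I_3) * plane R,
  SG p.2 /\ x = F2 q p.1.1 p.1.2 p.2.
Proof. by case: hSG => _ _ {1}-> [a _ [y sy <-]]; exists (a, y). Qed.

(** Let a coordinate attain its minimum over the compact set [SG] at [c], and write [c] as
    [F2 q k l y]. Then the minimum is at least a quarter of itself, hence nonnegative. *)
Lemma gasket_triangle : SG `<=` triangle q.
Proof.
move=> x sx i; case: (hSG) => S0 cS _.
have [c /set_mem sc hc] := compact_EVT_min S0 cS
  (continuous_subspaceT (continuous_bary (q:=q) (i:=i))).
apply: le_trans (hc _ (mem_set sx)).
have [[[k l] y] /= [sy e]] := gasket_decomp sc.
have := hc _ (mem_set sy); rewrite e bary_F2// => h.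
have : 0 <= (i == l)%:R :> R by []. have : 0 <= (i == k)%:R :> R by [].
by lra.
Qed.

Lemma closed_gasket : closed SG.
Proof. by case: hSG => _ cS _; apply: compact_closed => //; exact: norm_hausdorff. Qed.

(** Iterating [F2 q i i] from any point of the closed set [SG] stays in [SG] and converges to the
    fixed point [q i]. *)
Lemma gasket_vertex i : SG (q i).
Proof.
case: (hSG) => -[x sx] _ _.
have Fn n : iter n (F2 q i i) x = ((4^-1 : R) ^+ n) *: (x - q i) + q i.
  elim: n => [|n IH]; first by rewrite expr0 scale1r subrK.
  rewrite iterS IH /F2 /Fmap /= !addrK !scalerA exprS; congr (_ *: _ + _).
  by field.
apply: (@closed_cvg _ _ \oo _ (fun n => iter n (F2 q i i) x) SG) => //.
- exact: closed_gasket.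
- by apply: nearW => n; elim: n => //= n IH; exact: gasket_F2.
under eq_fun do rewrite Fn.
have h : (4^-1 : R) ^+ n *: (x - q i) + q i @[n --> \oo] -->
    (0 : R) *: (x - q i) + q i.
  apply: cvgD; last exact: cvg_cst.
  by apply: cvgZr_tmp; apply: cvg_expr; rewrite ger0_norm//; lra.
by rewrite scale0r add0r in h.
Qed.

Lemma gasket_word w x : SG x -> SG (Fword q w x).
Proof. by move=> sx; elim: w => //= a w; exact: gasket_F2. Qed.

Lemma closed_cell w : closed (Fword q w @` SG).
Proof.
apply: compact_closed; first exact: norm_hausdorff.
case: (hSG) => _ cS _.
apply: continuous_compact => //; apply: continuous_subspaceT.
elim: w => [|a w IH] x /=; first exact: cvg_id.
have cF i : continuous (Fmap q i).
  by move=> y; apply: cvgD; [apply: cvgZ; [exact: cvg_cst|apply: cvgB]|];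
    solve [exact: cvg_id | exact: cvg_cst].
apply: (@continuous_comp _ _ _ (Fword q w) (F2 q a.1 a.2)); first exact: IH.
by apply: (@continuous_comp _ _ _ (Fmap q a.2) (Fmap q a.1)); exact: cF.
Qed.

Lemma gasket_cells m x : SG x -> exists w y, [/\ size w = m, SG y & x = Fword q w y].
Proof.
elim: m x => [|m IH] x sx; first by exists [::], x.
have [[a y] /= [sy ->]] := gasket_decomp sx.
have [w [z [<- sz ->]]] := IH _ sy.
by exists (a :: w), z.
Qed.

End Gasket.

(** * Graph energies as sums over cells *)

Definition cell_res (R : realType) (r : R) (i j : 'I_3) : R :=
  if i == j then r0 r else r1 r.

Definition triangle_energy (R : realType) (a b : 'I_3 -> R) : R :=
  (a 0 - a 1) * (b 0 - b 1) + (a 1 - a 2%:R) * (b 1 - b 2%:R) +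
  (a 2%:R - a 0) * (b 2%:R - b 0).

Section GraphEnergy.
Context (R : realType) (q : 'I_3 -> plane R) (hq : is_triangle q) (r : R).
Implicit Types (x y : plane R) (u v : plane R -> R) (i j k : 'I_3).

Lemma edge0E x y :
  edge q 0 x y <-> exists j k, [/\ j != k, x = q j & y = q k].
Proof.
split=> [[w [j [k [/size0nil -> jk -> ->]]]]|[j [k [jk -> ->]]]].
  by exists j, k.
by exists [::], j, k.
Qed.

Lemma edgeSE m x y : edge q m.+1 x y <-> exists i j x' y',
  [/\ edge q m x' y', x = F2 q i j x' & y = F2 q i j y'].
Proof.
split.
  move=> [[|[i j] w] [k [l [//= [sw] kl -> ->]]]].
  by exists i, j, (Fword q w (q k)), (Fword q w (q l)); split=> //; exists w, k, l.
move=> [i [j [_ [_ [[w [k [l [sw kl -> ->]]]] -> ->]]]]].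
by exists ((i, j) :: w), k, l; rewrite /= sw.
Qed.

Lemma edge_triangle m x y : edge q m x y -> triangle q x /\ triangle q y.
Proof.
move=> [w [k [l [_ _ -> ->]]]].
by split; elim: w => [|a w IH] /=;
  solve [exact: triangle_vertex | exact: triangle_F2].
Qed.

Lemma edge_neq m x y : edge q m x y -> x <> y.
Proof.
move=> [w [k [l [_ kl -> ->]]]]; elim: w => [|a w IH] /=; last by move/F2_inj => /(_ hq).
move=> e; have := congr1 (bary q k) e; rewrite !bary_vertex// eqxx (negbTE kl).
by apply/eqP; exact: oner_neq0.
Qed.

(** Distinct cells share at most one point, so the two distinct endpoints of an edge determine its
    cell. *)
Lemma edge_cell_inj m i j i' j' x y x' y' : edge q m x y -> edge q m x' y' ->
  F2 q i j x = F2 q i' j' x' -> F2 q i j y = F2 q i' j' y' ->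
  [/\ i = i', j = j', x = x' & y = y'].
Proof.
move=> exy exy'; have [tx ty] := edge_triangle exy.
have [tx' ty'] := edge_triangle exy'; have xy := edge_neq exy.
move=> /(F2_meet hq tx tx') h1 /(F2_meet hq ty ty') h2.
case: h1 h2 => [[<- <- <-]|[ii jj xj _]|[ii ij ji xj _]] h2.
- by case: h2 => [[_ _ <-]|[_]|[]]; rewrite ?eqxx.
- case: h2 => [[_ e _]|[_ _ yj _]|[]]; last by rewrite ii eqxx.
    by rewrite e eqxx in jj.
  by case: xy; rewrite xj yj.
- case: h2 => [[e _ _]|[e _ _ _]|[_ _ _ yj _]]; try by rewrite e eqxx in ii.
  by case: xy; rewrite xj yj.
Qed.

(** A duplicate-free list of the oriented edges turns the sum over a finite set in [graph_energy]
    into an ordinary one that splits along cells. *)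
Fixpoint edges m : seq (plane R * plane R) :=
  if m is n.+1 then
    [seq (F2 q a.1 a.2 e.1, F2 q a.1 a.2 e.2)
      | a <- enum {: 'I_3 * 'I_3}, e <- edges n]
  else [seq (q p.1, q p.2) | p <- enum {: 'I_3 * 'I_3} & p.1 != p.2].

Lemma edgesP m e : (e \in edges m) <-> edge q m e.1 e.2.
Proof.
elim: m e => [|m IH] [x y] /=; split.
- move=> /mapP[[j k]]; rewrite mem_filter /= => /andP[jk _] [-> ->].
  by apply/edge0E; exists j, k.
- move=> /edge0E[j [k [jk -> ->]]]; apply/mapP; exists (j, k) => //.
  by rewrite mem_filter jk mem_enum.
- move=> /allpairsP[[[i j] [x' y']] /= [_ /IH e [-> ->]]].
  by apply/edgeSE; exists i, j, x', y'.
- move=> /edgeSE[i [j [x' [y' [e -> ->]]]]].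
  by apply/allpairsP; exists ((i, j), (x', y')); rewrite mem_enum; split=> //; apply/IH.
Qed.

Lemma edges_uniq m : uniq (edges m).
Proof.
elim: m => [|m IH] /=.
  rewrite map_inj_in_uniq; first by rewrite filter_uniq// enum_uniq.
  move=> [j k] [j' k'] _ _ /= [] e1 e2.
  by rewrite (vertex_inj hq e1) (vertex_inj hq e2).
apply: allpairs_uniq => //; first exact: enum_uniq.
move=> [[i j] [x y]] [[i' j'] [x' y']].
move=> /allpairsP[[? ?] /= [_ /edgesP /= h1 [? ?]]]; subst.
move=> /allpairsP[[? ?] /= [_ /edgesP /= h2 [? ?]]]; subst.
by move=> e; have [/= -> -> -> ->] :=
  edge_cell_inj h1 h2 (congr1 fst e) (congr1 snd e).
Qed.

(** By [edge_cell_inj] the set under [xget] in [res] has exactly one element. *)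
Lemma res_F2 m i j x y : edge q m x y ->
  res q r m.+1 (F2 q i j x) (F2 q i j y) = cell_res r i j * res q r m x y.
Proof.
move=> exy; rewrite [LHS]/=; apply: xget_unique; first by exists i, j, x, y.
move=> _ [i' [j' [x' [y' [exy' e1 e2 ->]]]]].
by have [<- <- <- <-] := edge_cell_inj exy exy' e1 e2.
Qed.

Lemma graph_energyE m u v : graph_energy q r m u v = 2^-1 *
  \sum_(e <- edges m) (res q r m e.1 e.2)^-1 * (u e.1 - u e.2) * (v e.1 - v e.2).
Proof.
rewrite /graph_energy; congr (_ * _).
have -> : [set e : plane R * plane R | edge q m e.1 e.2] = [set` edges m].
  by apply/seteqP; split=> e /=; move/edgesP.
by rewrite -fsbig_seq//; exact: edges_uniq.
Qed.

Lemma graph_energy0 u v :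
  graph_energy q r 0 u v = triangle_energy (u \o q) (v \o q).
Proof.
rewrite graph_energyE /= big_map big_filter big_enum_cond /=.
rewrite (eq_bigr (fun p => (u (q p.1) - u (q p.2)) * (v (q p.1) - v (q p.2))));
  last by move=> *; rewrite invr1 mul1r.
rewrite big_mkcond -(pair_bigA _ (fun j k : 'I_3 => if j != k then
  (u (q j) - u (q k)) * (v (q j) - v (q k)) else 0)) /=.
rewrite !big_ord3 ?eqxx ?ord3E /= /triangle_energy /=; by field.
Qed.

(** Self-similarity of the energy, splitting off the outermost letter. Inductions on the level rest
    on this form. *)
Lemma graph_energyS m u v : graph_energy q r m.+1 u v =
  \sum_i \sum_j (cell_res r i j)^-1 *
    graph_energy q r m (u \o F2 q i j) (v \o F2 q i j).
Proof.
rewrite graph_energyE /= big_allpairs_dep /= big_enum /=.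
rewrite (pair_bigA _ (fun i j => (cell_res r i j)^-1 *
    graph_energy q r m (u \o F2 q i j) (v \o F2 q i j))) /= big_distrr /=.
apply: eq_bigr => -[i j] _ /=; rewrite graph_energyE mulrCA; congr (_ * _).
rewrite big_distrr big_seq [RHS]big_seq /=; apply: eq_bigr => e /edgesP he.
have /= -> := res_F2 i j he; rewrite invfM; ring.
Qed.

End GraphEnergy.

(** * Harmonic extension to the first level *)

Section HarmonicExtension.
Context (R : realType) (r : R) (hr : 0 < r).
Implicit Types (b : 'I_3 -> R) (i j k : 'I_3).

(* [harm b i j k] is the value at [F_ij q_k] of the energy-minimizing extension of
   the boundary values [b] to V_1. Up to symmetry V_1 has three kinds of interior
   points, with quarter-barycentric coordinates [3e_i + e_j], [2e_i + 2e_j] and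
   [2e_i + e_j + e_k]; the formulas solve the Kirchhoff equations there. *)
Definition harm_edge b i j : R :=
  ((3 * r ^+ 2 + 5 * r) * (b 0 + b 1 + b 2%:R) + (9 * r + 15) * b i
   + 2 * r * b j) / Dr r.

Definition harm_mid b i j : R :=
  ((3 * r ^+ 2 + 6 * r + 1) * (b 0 + b 1 + b 2%:R)
   + (4 * r + 6) * (b i + b j)) / Dr r.

Definition harm_inner b i : R :=
  ((3 * r ^+ 2 + 7 * r + 2) * (b 0 + b 1 + b 2%:R) + (5 * r + 9) * b i) / Dr r.

Definition harm b i j k : R :=
  if i == j then if k == i then b i else harm_edge b i k
  else if k == i then harm_edge b i j
  else if k == j then harm_mid b i j else harm_inner b i.

Lemma Dr_gt0 : 0 < Dr r.
Proof. by rewrite /Dr; have := exprn_gt0 2 hr; have := hr; lra. Qed.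

Lemma r0_gt0 : 0 < r0 r.
Proof. by rewrite /r0 divr_gt0 ?Dr_gt0// !mulr_gt0//; have := hr; lra. Qed.

Lemma r1_gt0 : 0 < r1 r.
Proof. by rewrite /r1 divr_gt0 ?Dr_gt0// !mulr_gt0//; have := hr; lra. Qed.

Lemma cell_res_gt0 i j : 0 < cell_res r i j.
Proof. by rewrite /cell_res; case: ifP; rewrite (r0_gt0, r1_gt0). Qed.

Lemma harm_vertex b i : harm b i i i = b i.
Proof. by rewrite /harm !eqxx. Qed.

Lemma harmC b i j k : harm b i j k = harm b i k j.
Proof.
rewrite /harm; case: (ord3P i) => ->; case: (ord3P j) => ->;
  by case: (ord3P k) => ->; rewrite ?eqxx ?ord3E.
Qed.

Lemma harm_midC b i j : harm b i j j = harm b j i i.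
Proof.
rewrite /harm !eqxx [j == i]eq_sym; have [->//|_] := eqVneq i j.
by rewrite /harm_mid (addrC (b i)).
Qed.

Definition osc_ratio : R := 1 - (3 * r ^+ 2 + 10 * r + 7) / Dr r.

Lemma osc_ratio_ge0 : 0 <= osc_ratio.
Proof.
rewrite /osc_ratio subr_ge0 ler_pdivrMr ?Dr_gt0// mul1r /Dr.
by have := exprn_gt0 2 hr; have := hr; lra.
Qed.

Lemma osc_ratio_lt1 : osc_ratio < 1.
Proof.
rewrite /osc_ratio ltrBlDr ltrDl divr_gt0 ?Dr_gt0//.
by have := exprn_gt0 2 hr; have := hr; lra.
Qed.

(* Every value on the cell [F_ij] gives the boundary value [b i] weight at least
   [1 - osc_ratio], which is the weight of [b i] in [harm_mid]. *)
Lemma harm_range b lo hi i j k : (forall l, lo <= b l <= hi) ->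
  osc_ratio * lo + (1 - osc_ratio) * b i <= harm b i j k
  <= osc_ratio * hi + (1 - osc_ratio) * b i.
Proof.
(* Here [w'] is [Dr r - w], the numerator of [osc_ratio]. Once [Dr r] is cleared, the claim is
   linear in the bounds on [b l], [r * b l] and [r ^+ 2 * b l]. *)
move=> bl; set w := 3 * r ^+ 2 + 10 * r + 7; set w' := 6 * r ^+ 2 + 16 * r + 8.
have D0 := Dr_gt0.
have cE c : osc_ratio * c + (1 - osc_ratio) * b i = (w' * c + w * b i) / Dr r.
  move: (lt0r_neq0 D0); rewrite /osc_ratio /w /w' /Dr => ?; by field.
rewrite !cE.
have Dm x : x / Dr r * Dr r = x by rewrite divfK// gt_eqF.
have Di x y : (x / Dr r <= y) = (x <= y * Dr r) by rewrite ler_pdivrMr.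
have Di' x y : (y <= x / Dr r) = (y * Dr r <= x) by rewrite ler_pdivlMr.
rewrite Di Di'.
have lb l : [/\ lo <= b l, r * lo <= r * b l & r ^+ 2 * lo <= r ^+ 2 * b l].
  by case/andP: (bl l) => bl1 _; split=> //; rewrite ler_pM2l ?exprn_gt0.
have ub l : [/\ b l <= hi, r * b l <= r * hi & r ^+ 2 * b l <= r ^+ 2 * hi].
  by case/andP: (bl l) => _ bl1; split=> //; rewrite ler_pM2l ?exprn_gt0.
rewrite /w /w' /harm /harm_edge /harm_mid /harm_inner.
apply/andP; split.
  have [? ? ?] := lb 0; have [? ? ?] := lb 1; have [? ? ?] := lb 2%:R.
  clear lb ub bl hr D0 Di Di'.
  case: (ord3P i) => ->; case: (ord3P j) => ->; case: (ord3P k) => ->;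
    by rewrite ?eqxx ?ord3E /= ?Dm /Dr; lra.
have [? ? ?] := ub 0; have [? ? ?] := ub 1; have [? ? ?] := ub 2%:R.
clear lb ub bl hr D0 Di Di'.
case: (ord3P i) => ->; case: (ord3P j) => ->; case: (ord3P k) => ->;
  by rewrite ?eqxx ?ord3E /= ?Dm /Dr; lra.
Qed.

(** The hypotheses say that [a] comes from a function on V_1: F_ij q_k = F_ik q_j and F_ij q_j =
    F_ji q_i. The Kirchhoff equations cancel the coefficients of the interior values of [a]; [r0]
    and [r1] are scaled so that the corners give exactly the energy of level zero. *)
Lemma triangle_energy_harm (a : 'I_3 -> 'I_3 -> 'I_3 -> R) b :
  (forall i j k, a i j k = a i k j) -> (forall i j, a i j j = a j i i) ->
  \sum_i \sum_j (cell_res r i j)^-1 * triangle_energy (a i j) (harm b i j) =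
  triangle_energy (fun i => a i i i) b.
Proof.
move=> aC aM; rewrite !big_ord3 /triangle_energy /cell_res /harm.
rewrite ?eqxx ?ord3E /=.
(* One name is kept for each of the 15 points of V_1; what remains is a rational identity. *)
rewrite (aC 0 1 0) (aC 0 2%:R 0) (aC 0 2%:R 1) (aC 1 0 1) (aC 1 2%:R 1)
  (aC 1 2%:R 0) (aC 2%:R 0 2%:R) (aC 2%:R 1 2%:R) (aC 2%:R 1 0).
rewrite (aM 1 0) (aM 2%:R 0) (aM 2%:R 1).
rewrite /harm_edge /harm_mid /harm_inner /r0 /r1.
have D0 : Dr r != 0 by rewrite gt_eqF// Dr_gt0.
have rn : r != 0 by rewrite gt_eqF.
have r2 : r + 2 != 0 by rewrite gt_eqF//; have := hr; lra.
move: D0; rewrite /Dr => D0.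
by field; rewrite D0 r2.
Qed.

End HarmonicExtension.

(** * Harmonic functions on the gasket *)

Section HarmonicFunctions.
Context (R : realType) (q : 'I_3 -> plane R) (SG : set (plane R)) (r : R).
Hypotheses (hq : is_triangle q) (hSG : is_gasket q SG) (hr : 0 < r).
Implicit Types (x y : plane R) (b : 'I_3 -> R) (f : plane R -> R)
  (i j k : 'I_3).

(** A junction point lies in two cells and the choice between them is arbitrary; [harm_fun_F2] shows
    that harmonic functions do not depend on it. *)
Definition address x : ('I_3 * 'I_3) * plane R :=
  xget ((0, 0), x) [set p | SG p.2 /\ x = F2 q p.1.1 p.1.2 p.2].

Lemma addressP x : SG x -> SG (address x).2 /\
  x = F2 q (address x).1.1 (address x).1.2 (address x).2.
Proof.
move=> sx; rewrite /address; case: xgetP => [p _ //|] none.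
by have [p hp] := gasket_decomp hSG sx; case: (none p).
Qed.

Fixpoint harm_max n b x : R :=
  if n is m.+1 then
    harm_max m (harm r b (address x).1.1 (address x).1.2) (address x).2
  else Num.max (b 0) (Num.max (b 1) (b 2%:R)).

(* Extending harmonically [n] times along the address of [x] leaves the values at
   the vertices of a cell of level [n] containing [x]; their maximum decreases in
   [n]. *)
Definition harm_fun b x : R := limn (fun n => harm_max n b x).

Lemma harm_bounds b lo hi i j k :
  (forall l, lo <= b l <= hi) -> lo <= harm r b i j k <= hi.
Proof.
move=> bl; have /andP[h1 h2] := harm_range hr i j k bl.
have := osc_ratio_ge0 hr; have := osc_ratio_lt1 hr; have /andP[? ?] := bl i.
by move=> ? ?; apply/andP; split; nra.
Qed.

Lemma harm_max_bounds n b x lo hi :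
  (forall l, lo <= b l <= hi) -> lo <= harm_max n b x <= hi.
Proof.
move=> bl; elim: n b x bl => [|n IH] b x bl /=.
  rewrite !le_max !ge_max; have /andP[-> ->] := bl 0; have /andP[_ ->] := bl 1.
  by have /andP[_ ->] := bl 2%:R.
by apply: IH => l; exact: harm_bounds.
Qed.

Lemma bounds_exist b : exists lo hi, forall l, lo <= b l <= hi.
Proof.
exists (Num.min (b 0) (Num.min (b 1) (b 2%:R))).
exists (Num.max (b 0) (Num.max (b 1) (b 2%:R))) => l.
by case: (ord3P l) => ->; rewrite !le_max !ge_min !lexx ?orbT.
Qed.

(** Following the address reduces this to one extension step, where it is the maximum principle
    [harm_bounds]. *)
Lemma harm_max_le b x : {homo (fun n => harm_max n b x) : m n / (m <= n)%N >-> n <= m}.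
Proof.
apply/nonincreasing_seqP => n; elim: n b x => [|n IH] b x; last exact: IH.
have [lo [hi bl]] := bounds_exist b.
rewrite [leRHS]/=; set M := Num.max _ _.
suff : lo <= harm_max 1 b x <= M by case/andP.
apply: harm_max_bounds => l; case/andP: (bl l) => -> _ /=.
by case: (ord3P l) => ->; rewrite /M !le_max lexx ?orbT.
Qed.

Lemma cvg_harm_max b x : cvgn (fun n => harm_max n b x).
Proof.
apply: nonincreasing_is_cvgn; first exact: harm_max_le.
have [lo [hi bl]] := bounds_exist b.
by exists lo => _ [n _ <-]; case/andP: (harm_max_bounds n x bl).
Qed.

Lemma harm_fun_bounds b x lo hi :
  (forall l, lo <= b l <= hi) -> lo <= harm_fun b x <= hi.
Proof.
move=> bl; apply/andP; split.
  by apply: limr_ge; [exact: cvg_harm_max|apply: nearW => n];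
    case/andP: (harm_max_bounds n x bl).
by apply: limr_le; [exact: cvg_harm_max|apply: nearW => n];
  case/andP: (harm_max_bounds n x bl).
Qed.

Lemma harm_fun_address b x : harm_fun b x =
  harm_fun (harm r b (address x).1.1 (address x).1.2) (address x).2.
Proof.
apply/esym/cvg_lim; first exact: Rhausdorff.
have := @cvg_harm_max b x; by rewrite -cvg_shiftS.
Qed.

(** A boundary vertex lies in one cell only, so here the choice is forced. *)
Lemma address_vertex j : address (q j) = ((j, j), q j).
Proof.
have [sy e] := addressP (gasket_vertex hSG j).
move: (address (q j)) sy e => [[i k] y] /= sy e.
move: (e); rewrite -[LHS](F2_vertex q j) => /esym.
move=> /(F2_meet hq (gasket_triangle hq hSG sy) (triangle_vertex hq j)).
case=> [[-> -> ->] //|[_ kj _ /vertex_inj]|[ij jk ji _ _]].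
  by move=> /(_ hq) jk; rewrite jk eqxx in kj.
by rewrite ji eqxx in ij.
Qed.

(** The address of [q j] repeats [(j, j)]. Each step keeps [b j] among the vertex values and shrinks
    their range by [osc_ratio r]. *)
Lemma harm_fun_vertex b j : harm_fun b (q j) = b j.
Proof.
have [lo [hi bl]] := bounds_exist b.
have H n : `|harm_fun b (q j) - b j| <= osc_ratio r ^+ n * (hi - lo).
  elim: n b lo hi bl => [|n IH] b lo hi bl.
    have /andP[? ?] := harm_fun_bounds (q j) bl; have /andP[? ?] := bl j.
    by rewrite expr0 mul1r ler_norml; apply/andP; split; lra.
  rewrite harm_fun_address address_vertex /=.
  have := IH _ _ _ (fun l => harm_range hr j j l bl); rewrite harm_vertex.
  by congr (_ <= _); rewrite exprSr; ring.
apply/eqP; rewrite -subr_eq0 -normr_le0.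
have c : osc_ratio r ^+ n * (hi - lo) @[n --> \oo] --> (0 : R) * (hi - lo).
  apply: cvgM; last exact: cvg_cst.
  by apply: cvg_expr; rewrite ger0_norm ?osc_ratio_ge0 ?osc_ratio_lt1.
by rewrite mul0r in c; apply: (cvgr_to_ge c); exact: nearW.
Qed.

(** The chosen address of [F2 q i j y] may name another cell. Then [F2_meet] makes it a junction
    point, where both sides are vertex values, equal by [harmC] or [harm_midC]. *)
Lemma harm_fun_F2 b i j y : SG y ->
  harm_fun b (F2 q i j y) = harm_fun (harm r b i j) y.
Proof.
move=> sy; rewrite harm_fun_address.
have [sx] := addressP (gasket_F2 hSG i j sy).
move: (address _) sx => [[i' j'] x] /= sx.
move=> /(F2_meet hq (gasket_triangle hq hSG sy) (gasket_triangle hq hSG sx)).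
case=> [[-> -> -> //]|[<- _ -> ->]|[_ -> -> -> ->]]; rewrite !harm_fun_vertex.
  exact: harmC.
by rewrite harm_midC.
Qed.

Lemma harm_fun_osc b lo hi w x y : (forall l, lo <= b l <= hi) -> SG x -> SG y ->
  `|harm_fun b (Fword q w x) - harm_fun b (Fword q w y)|
  <= osc_ratio r ^+ size w * (hi - lo).
Proof.
move=> + sx sy; elim: w b lo hi => [|a w IH] b lo hi bl /=.
  have /andP[? ?] := harm_fun_bounds x bl; have /andP[? ?] := harm_fun_bounds y bl.
  by rewrite expr0 mul1r ler_norml; apply/andP; split; lra.
rewrite !harm_fun_F2; try exact: gasket_word.
have := IH _ _ _ (fun l => harm_range hr a.1 a.2 l bl).
by congr (_ <= _); rewrite exprSr; ring.
Qed.

(** * Oscillation on small cells and continuity *)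

Definition small_osc f := forall e, 0 < e -> exists m, forall w, (m <= size w)%N ->
  forall x y, SG x -> SG y -> `|f (Fword q w x) - f (Fword q w y)| <= e.

(** The finitely many cells of level [m] that miss [x] are closed. Off their union, every nearby
    point of [SG] shares a cell of level [m] with [x]. *)
Lemma small_osc_continuous f : small_osc f -> {within SG, continuous f}.
Proof.
move=> of_; apply/subspace_continuousP => x sx.
apply/cvgrPdist_le => e e0; have [m hm] := of_ _ e0.
pose P (w : m.-tuple ('I_3 * 'I_3)%type) : set (plane R) :=
  [set y | (Fword q w @` SG) y -> (Fword q w @` SG) x].
have : nbhs x [set y | forall w, P w y].
  apply: (@filter_forall (plane R) (m.-tuple ('I_3 * 'I_3)%type) P (nbhs x)) => w.
  have [wx|nwx] := pselect ((Fword q w @` SG) x).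
    by apply: nearW => y _.
  have : nbhs x (~` (Fword q w @` SG)).
    by apply: open_nbhs_nbhs; split=> //; exact/closed_openC/closed_cell.
  by apply: filterS => y /= nwy wy; case: nwy.
rewrite near_withinE; apply: filterS => y H sy.
have [w [z [sw sz yE]]] := gasket_cells hSG m sy.
have /eqP sw' := sw; have [t st xE] := H (Tuple sw') (ex_intro2 _ _ z sz (esym yE)).
by rewrite yE -xE; apply: hm => //; rewrite sw.
Qed.

Lemma small_osc_ext f g : (forall x, SG x -> f x = g x) -> small_osc f -> small_osc g.
Proof.
move=> fg hf e /hf[m hm]; exists m => w mw x y sx sy.
by rewrite -!fg; [exact: hm|exact: gasket_word..].
Qed.

(** This is why continuity is handled through oscillations: functions defined cell by cell, such as
    [spike], need no separate argument at junction points. *)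
Lemma small_osc_glue f : (forall i j, small_osc (f \o F2 q i j)) -> small_osc f.
Proof.
move=> of_ e e0.
have /choice[m hm] : forall a : 'I_3 * 'I_3, exists m, forall w, (m <= size w)%N ->
    forall x y, SG x -> SG y ->
    `|f (F2 q a.1 a.2 (Fword q w x)) - f (F2 q a.1 a.2 (Fword q w y))| <= e.
  by move=> a; exact: of_.
(* The extra letter is the first one, which selects the cell. *)
exists (\max_a m a).+1 => -[//|a w] /= mw x y; apply: hm.
by apply: leq_trans _ (mw : (\max_a m a <= size w)%N); exact: leq_bigmax.
Qed.

Lemma small_osc_harm_fun b : small_osc (harm_fun b).
Proof.
move=> e e0; have [lo [hi bl]] := bounds_exist b.
have c : osc_ratio r ^+ n * (hi - lo) @[n --> \oo] --> (0 : R) * (hi - lo).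
  apply: cvgM; last exact: cvg_cst.
  by apply: cvg_expr; rewrite ger0_norm ?osc_ratio_ge0 ?osc_ratio_lt1.
rewrite mul0r in c; have /cvgrPdist_le/(_ _ e0)[m _ hm] := c.
exists m => w mw x y sx sy; apply: le_trans (harm_fun_osc w bl sx sy) _.
by apply: le_trans (hm _ mw); rewrite sub0r normrN ler_norm.
Qed.

(** * Functions concentrated near a boundary vertex *)

Definition unit_vec i : 'I_3 -> R := fun j => (i == j)%:R.

(* The psi_m of the header; [4 *: (x - q i) + q i] is the inverse of [F_ii]. *)
Fixpoint spike i m x : R :=
  if m is n.+1 then
    if `[< (F2 q i i @` SG) x >] then spike i n (4 *: (x - q i) + q i) else 0
  else harm_fun (unit_vec i) x.

Lemma F2_diagK i x : 4 *: (F2 q i i x - q i) + q i = x.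
Proof.
rewrite /F2 /Fmap /= !addrK !scalerA.
by rewrite (_ : 4 * (2^-1 * 2^-1) = 1 :> R) ?scale1r ?subrK//; field.
Qed.

Lemma spike_F2_diag i m x : SG x -> spike i m.+1 (F2 q i i x) = spike i m x.
Proof.
move=> sx /=; rewrite ifT; last by apply/asboolP; exists x.
by rewrite F2_diagK.
Qed.

(** Another cell meets the cell F_ii only at the images of vertices [q j'] with [j'] different from
    [i], where the spike of level [m] is 0. The vertex values are a hypothesis because
    [spike_vertex] uses this step in its induction. *)
Let spike_F2_off_step i m i' j' y : (forall j, spike i m (q j) = (i == j)%:R) ->
  (i', j') != (i, i) -> SG y -> spike i m.+1 (F2 q i' j' y) = 0.
Proof.
move=> hv ij sy /=; case: asboolP => // -[x sx e].
rewrite -e F2_diagK.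
move: e => /(F2_meet hq (gasket_triangle hq hSG sx) (gasket_triangle hq hSG sy)).
case=> [[ii jj _]|[_ jj -> _]|[ii e1 _ _ _]].
- by rewrite -ii -jj eqxx in ij.
- by rewrite hv (negbTE jj).
- by rewrite e1 eqxx in ii.
Qed.

Lemma spike_vertex i j m : spike i m (q j) = (i == j)%:R.
Proof.
elim: m j => [|m IH] j; first by rewrite /= harm_fun_vertex.
have sj := gasket_vertex hSG j; rewrite -{1}(F2_vertex q j).
have [ij|ij] := eqVneq i j; first by subst i; rewrite spike_F2_diag// IH eqxx.
by rewrite spike_F2_off_step//; apply: contra ij => /eqP[->].
Qed.

Lemma spike_F2_off i m i' j' y :
  (i', j') != (i, i) -> SG y -> spike i m.+1 (F2 q i' j' y) = 0.
Proof. by apply: spike_F2_off_step => j; rewrite spike_vertex. Qed.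

Lemma spike_bounds i m x : 0 <= spike i m x <= 1.
Proof.
elim: m x => [|m IH] x /=; last by case: asboolP; rewrite ?lexx ?ler01.
by apply: harm_fun_bounds => l; rewrite /unit_vec ler0n lern1 leq_b1.
Qed.

Lemma small_osc_spike i m : small_osc (spike i m).
Proof.
elim: m => [|m IH]; first exact: small_osc_harm_fun.
apply: small_osc_glue => i' j'; have [[-> ->]|ij] := eqVneq (i', j') (i, i).
  by apply: small_osc_ext IH => x sx; rewrite [RHS]/comp spike_F2_diag.
have h0 : small_osc (fun=> 0).
  by move=> e e0; exists 0%N => *; rewrite subrr normr0 ltW.
by apply: small_osc_ext h0 => x sx; rewrite [RHS]/comp spike_F2_off.
Qed.

Lemma spike_support i m x :
  ~ (iter m (fun A => F2 q i i @` A) SG) x -> SG x -> spike i m x = 0.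
Proof.
elim: m x => [//|m IH] x /= nx sx; case: asboolP => // -[y sy e].
rewrite -e F2_diagK; apply: IH => // ys.
by apply: nx; exists y.
Qed.

End HarmonicFunctions.

(** * The limit energy *)

Section Energies.
Context (R : realType) (q : 'I_3 -> plane R) (SG : set (plane R)) (r : R).
Hypotheses (hq : is_triangle q) (hSG : is_gasket q SG) (hr : 0 < r).
Implicit Types (x y : plane R) (u v w : plane R -> R) (b : 'I_3 -> R)
  (i j k : 'I_3).

Lemma graph_energy_ext m u u' v v' :
  (forall x, SG x -> u x = u' x) -> (forall x, SG x -> v x = v' x) ->
  graph_energy q r m u v = graph_energy q r m u' v'.
Proof.
elim: m u u' v v' => [|m IH] u u' v v' eu ev.
  by rewrite !graph_energy0// /triangle_energy /= !eu ?ev//; exact: (gasket_vertex hSG).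
rewrite !graph_energyS//; apply: eq_bigr => i _; apply: eq_bigr => j _.
by congr (_ * _); apply: IH => x sx /=; rewrite (eu, ev)//; exact: (gasket_F2 hSG).
Qed.

Lemma graph_energy_eq0 m u v :
  (forall x, SG x -> v x = 0) -> graph_energy q r m u v = 0.
Proof.
move=> v0; rewrite (@graph_energy_ext m u u v (fun=> 0))//.
by rewrite graph_energyE// big1 ?mulr0// => e _; rewrite subrr mulr0.
Qed.

Lemma graph_energyC m u v : graph_energy q r m u v = graph_energy q r m v u.
Proof. by rewrite !graph_energyE//; congr (_ * _); apply: eq_bigr => *; ring. Qed.

Lemma graph_energy_linear m c u w v :
  graph_energy q r m (fun x => c * u x + w x) v =
  c * graph_energy q r m u v + graph_energy q r m w v.
Proof.
rewrite !graph_energyE// mulrCA -mulrDr; congr (_ * _).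
by rewrite big_distrr -big_split /=; apply: eq_bigr => *; ring.
Qed.

Lemma graph_energy_ge0 m u : 0 <= graph_energy q r m u u.
Proof.
elim: m u => [|m IH] u; last first.
  rewrite graph_energyS//; apply: sumr_ge0 => i _; apply: sumr_ge0 => j _.
  by rewrite mulr_ge0// invr_ge0 ltW// cell_res_gt0.
by rewrite graph_energy0// /triangle_energy -!expr2 !addr_ge0// sqr_ge0.
Qed.

(** On each cell the function is again harmonic, with boundary values [harm r b i j]; by induction
    each cell contributes a triangle energy, and [triangle_energy_harm] sums them. *)
Lemma graph_energy_harm_fun m u b :
  graph_energy q r m u (harm_fun q SG r b) = triangle_energy (u \o q) b.
Proof.
elim: m u b => [|m IH] u b.
  by rewrite graph_energy0// /triangle_energy /= !harm_fun_vertex.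
rewrite graph_energyS//.
transitivity (\sum_i \sum_j (cell_res r i j)^-1 *
    triangle_energy (u \o F2 q i j \o q) (harm r b i j)).
  apply: eq_bigr => i _; apply: eq_bigr => j _; congr (_ * _); rewrite -IH.
  by apply: graph_energy_ext => x sx //=; rewrite harm_fun_F2.
rewrite (triangle_energy_harm hr (a := fun i j k => u (F2 q i j (q k)))) /=.
- by rewrite /triangle_energy /= !F2_vertex.
- by move=> i j k; rewrite F2_vertexC.
- by move=> i j; rewrite F2_midC.
Qed.

(** Only the cell F_ii^m contributes. Each passage to F_ii costs a factor [(r0 r)^-1], and on the
    last cell the spike is harmonic, so [n] disappears. *)
Lemma graph_energy_spike m n i u : graph_energy q r (m + n) u (spike q SG r i m) =
  r0 r ^- m * triangle_energy (fun j => u (iter m (F2 q i i) (q j))) (unit_vec R i).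
Proof.
elim: m u => [|m IH] u.
  by rewrite add0n expr0 invr1 mul1r /= graph_energy_harm_fun.
rewrite addSn graph_energyS// (bigD1 i)//= (bigD1 i)//= [X in _ + X]big1; last first.
  move=> i' i'i; apply: big1 => j _; rewrite graph_energy_eq0 ?mulr0// => x sx.
  by apply: spike_F2_off => //; apply: contra i'i => /eqP[->].
rewrite [X in _ + X + _]big1; last first.
  move=> j ji; rewrite graph_energy_eq0 ?mulr0// => x sx.
  by apply: spike_F2_off => //; apply: contra ji => /eqP[->].
rewrite !addr0 (@graph_energy_ext _ _ (u \o F2 q i i) _ (spike q SG r i m))//.
  by rewrite IH /cell_res eqxx mulrA -[X in X * _]invfM -exprS.
by move=> x sx; exact: spike_F2_diag.
Qed.

Lemma triangle_energy_unit (a : 'I_3 -> R) i :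
  triangle_energy a (unit_vec R i) = 2 * a i - a (i + 1) - a (i - 1).
Proof.
rewrite /triangle_energy /unit_vec.
by case: (ord3P i) => ->; rewrite ?ord3D ?ord3E ?eqxx /=; ring.
Qed.

(* The difference between [u] and the harmonic function with the same boundary
   values is orthogonal to the latter. *)
Lemma graph_energy_homo u : {homo (fun m => graph_energy q r m u u) :
  m n / (m <= n)%N >-> m <= n}.
Proof.
apply/nondecreasing_seqP => m; elim: m u => [|m IH] u; last first.
  rewrite graph_energyS// [leRHS]graph_energyS//.
  apply: ler_sum => i _; apply: ler_sum => j _.
  by rewrite ler_wpM2l// invr_ge0 ltW// cell_res_gt0.
set h := harm_fun q SG r (u \o q).
have := graph_energy_ge0 1 (fun x => -1 * h x + u x).
rewrite graph_energy_linear !(graph_energyC _ _ (fun x => -1 * h x + u x)).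
rewrite !graph_energy_linear (graph_energyC 1 h u) !graph_energy_harm_fun.
rewrite graph_energy0//; set s := triangle_energy (u \o q) (u \o q).
rewrite (_ : triangle_energy (h \o q) (u \o q) = s); first by lra.
by rewrite /s /h /triangle_energy /= !harm_fun_vertex.
Qed.

(** By monotonicity the extended-real limit is the supremum of the graph energies. *)
Lemma energy_lt_pinfty u :
  (energy q r u u < +oo)%E <-> exists M, forall m, graph_energy q r m u u <= M.
Proof.
have nd : nondecreasing_seq (fun m => (graph_energy q r m u u)%:E).
  by move=> m n mn; rewrite lee_fin graph_energy_homo.
rewrite /energy (cvg_lim _ (ereal_nondecreasing_cvgn nd))//; split=> [|[M hM]].
  move=> lty.
  exists (fine (ereal_sup (range (fun m => (graph_energy q r m u u)%:E)))) => m.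
  have le0 : ((graph_energy q r m u u)%:E <=
      ereal_sup (range (fun m => (graph_energy q r m u u)%:E)))%E.
    by apply: ereal_sup_ubound; exists m.
  rewrite -lee_fin fineK// fin_numElt lty andbT.
  by apply: lt_le_trans le0; rewrite ltNyr.
apply: (@le_lt_trans _ _ M%:E); last exact: ltry.
by apply: ge_ereal_sup => _ [m _ <-]; rewrite lee_fin.
Qed.

Lemma dom_energy_linear c u v : dom_energy q SG r u -> dom_energy q SG r v ->
  dom_energy q SG r (fun x => c * u x + v x).
Proof.
move=> [cu /energy_lt_pinfty[M hM]] [cv /energy_lt_pinfty[N hN]]; split.
  move=> x; apply: cvgD; last exact: cv.
  by apply: cvgM; [exact: cvg_cst|exact: cu].
(* The bound is the parallelogram law: the energies of [c u + v] and [v - c u] add up to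
   [2 c^2 E(u) + 2 E(v)], and the second one is nonnegative. *)
apply/energy_lt_pinfty; exists (2 * c ^+ 2 * M + 2 * N) => m.
have := graph_energy_ge0 m (fun x => - c * u x + v x).
rewrite !(graph_energy_linear, graph_energyC _ _ (fun x => _ * u x + v x)).
have : c ^+ 2 * graph_energy q r m u u <= c ^+ 2 * M.
  by rewrite ler_wpM2l// sqr_ge0.
rewrite (graph_energyC m u v).
by have := hN m; lra.
Qed.

Lemma dom_energy_small_osc v : small_osc q SG v ->
  (exists m, forall n, graph_energy q r (m + n) v v = graph_energy q r m v v) ->
  dom_energy q SG r v.
Proof.
move=> ov [m hm]; split; first exact: small_osc_continuous ov.
apply/energy_lt_pinfty; exists (graph_energy q r m v v) => n.
by rewrite -(hm n) graph_energy_homo// leq_addl.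
Qed.

Lemma dom_energy_spike i m : dom_energy q SG r (spike q SG r i m).
Proof.
apply: dom_energy_small_osc; first exact: small_osc_spike.
exists m => n; rewrite graph_energy_spike.
by have := graph_energy_spike m 0 i (spike q SG r i m); rewrite addn0 => ->.
Qed.

(** Polarization reduces this to the diagonal case, where the sequence is monotone and bounded. *)
Lemma cvg_graph_energy u v : dom_energy q SG r u -> dom_energy q SG r v ->
  cvgn (fun m => graph_energy q r m u v).
Proof.
have diag w : dom_energy q SG r w -> cvgn (fun m => graph_energy q r m w w).
  move=> [_ /energy_lt_pinfty[M hM]]; apply: nondecreasing_is_cvgn.
    exact: graph_energy_homo.
  by exists M => _ [m _ <-].
move=> du dv.
rewrite (_ : (fun m => _) = (fun m => 4^-1 *
  (graph_energy q r m (fun x => 1 * u x + v x) (fun x => 1 * u x + v x) -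
   graph_energy q r m (fun x => -1 * u x + v x) (fun x => -1 * u x + v x)))).
  apply: is_cvgM; first exact: is_cvg_cst.
  by apply: is_cvgB; apply: diag; exact: dom_energy_linear.
apply/funext => m.
rewrite !(graph_energy_linear, graph_energyC _ _ (fun x => _ * u x + v x)).
by rewrite (graph_energyC m v u); field.
Qed.

Definition energyR u v : R := limn (fun m => graph_energy q r m u v).

Lemma energyE u v : dom_energy q SG r u -> dom_energy q SG r v ->
  energy q r u v = (energyR u v)%:E.
Proof. by move=> du dv; rewrite -EFin_lim//; exact: cvg_graph_energy. Qed.

Lemma energyR_linear u c w v : dom_energy q SG r u -> dom_energy q SG r v ->
  dom_energy q SG r w ->
  energyR u (fun x => c * w x + v x) = c * energyR u w + energyR u v.
Proof.
move=> du dv dw; apply: cvg_lim; first exact: Rhausdorff.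
under eq_fun do rewrite graph_energyC graph_energy_linear !(graph_energyC _ _ u).
apply: cvgD; last exact: cvg_graph_energy.
by apply: cvgM; [exact: cvg_cst|exact: cvg_graph_energy].
Qed.

(** The graph energies are constant from level [m] on. *)
Lemma energyR_spike u i m : energyR u (spike q SG r i m) = normal_diff q r u i m.
Proof.
apply: cvg_lim; first exact: Rhausdorff.
rewrite -(cvg_shiftn m) /=.
apply: cvg_near_cst; apply: nearW => n /=.
rewrite addnC graph_energy_spike triangle_energy_unit /normal_diff /lambda_sym.
by rewrite (_ : iter m _ (q i) = q i)//; elim: m => //= m ->; rewrite F2_vertex.
Qed.

End Energies.

(** * Integration against a Borel measure on the plane *)

Section BorelPlane.
Context (R : realType) (mu : probability (borelPlane R) R).
Implicit Types (A : set (plane R)) (f g : plane R -> R).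

Lemma closed_borel A : closed A -> measurable (A : set (borelPlane R)).
Proof.
move=> cA; rewrite -(setCK (A : set (borelPlane R))); apply: measurableC.
by apply: sub_sigma_algebra; exact: closed_openC.
Qed.

Lemma within_continuous_borel A f : closed A -> {within A, continuous f} ->
  measurable_fun (A : set (borelPlane R)) (f : borelPlane R -> R).
Proof.
move=> cA /continuousP cf.
apply: (measurability _ (measurable_realfun.RGenOpens.measurableE R)).
move=> _ [_ [a [b ->] <-]]; have := cf _ (@interval_open _ (BRight a) (BLeft b) isT isT).
move=> /open_subspaceP[V oV VE]; rewrite setIC -VE.
apply: measurableI; last exact: closed_borel.
exact: sub_sigma_algebra.
Qed.

Lemma within_continuous_integrable A f : compact A -> {within A, continuous f} ->
  mu.-integrable (A : set (borelPlane R)) (EFin \o (f : borelPlane R -> R)).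
Proof.
move=> cA cf; have clA : closed A by apply: compact_closed => //; exact: norm_hausdorff.
apply: measurable_bounded_integrable.
- exact: closed_borel.
- by apply: le_lt_trans (ltry 1); exact: probability_le1 (closed_borel clA).
- exact: within_continuous_borel.
have [M [Mr hM]] := compact_bounded (continuous_compact cf cA).
by exists M; split=> // x Mx y Ay; apply: hM => //; exists y.
Qed.

End BorelPlane.

(** * The Gauss-Green formula *)

Section GaussGreen.
Context (R : realType) (q : 'I_3 -> plane R) (SG : set (plane R)) (r : R)
  (mu : probability (borelPlane R) R).
Hypotheses (hq : is_triangle q) (hSG : is_gasket q SG) (hr : 0 < r)
  (hmu : is_self_similar_measure q SG r mu).
Context (u Lu : plane R -> R) (hu : is_laplacian q SG r mu u Lu).
Implicit Types (v w : plane R -> R) (i : 'I_3).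

Let cell i m := iter m (fun A => F2 q i i @` A) SG.

Lemma mu0_bounds : 0 < mu0 r < 1.
Proof.
have h : 1 < 3 * (2 * r + 1) by have := hr; lra.
by rewrite /mu0 invr_gt0 invf_lt1 ?(lt_trans ltr01 h).
Qed.

Lemma compact_gasket : compact SG. Proof. by case: hSG. Qed.

Lemma measurable_gasket : measurable (SG : set (borelPlane R)).
Proof. exact: closed_borel (closed_gasket hSG). Qed.

Lemma cellE i m : cell i m = Fword q (nseq m (i, i)) @` SG.
Proof.
elim: m => [|m IH]; first by rewrite [RHS]image_id.
by rewrite /cell iterS -/(cell i m) IH image_comp.
Qed.

Lemma measurable_cell i m : measurable (cell i m : set (borelPlane R)).
Proof. by rewrite cellE; apply: closed_borel; exact: closed_cell. Qed.

Lemma cell_sub i m : cell i m `<=` SG.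
Proof. by rewrite cellE => _ [x sx <-]; exact: (gasket_word hSG). Qed.

Lemma mu_cell i m : mu (cell i m) = ((mu0 r) ^+ m)%:E.
Proof.
case: hmu => m1 mS; elim: m => [|m IH]; first by rewrite expr0.
rewrite /cell iterS -/(cell i m) mS ?eqxx ?IH ?exprS//.
- exact: measurable_cell.
- exact: cell_sub.
Qed.

Lemma mul_Lu_integrable v : {within SG, continuous v} ->
  mu.-integrable (SG : set (borelPlane R))
    (EFin \o (fun x : borelPlane R => v x * Lu x)).
Proof.
case: hu => _ cL _ cv; apply: within_continuous_integrable => //.
  exact: compact_gasket.
by move=> x; apply: cvgM; [exact: cv|exact: cL].
Qed.

Definition pairing v : R := \int[mu]_(x in (SG : set (borelPlane R))) (v x * Lu x).

Lemma pairingE v : {within SG, continuous v} ->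
  (\int[mu]_(x in (SG : set (borelPlane R))) (v x * Lu x)%:E = (pairing v)%:E)%E.
Proof.
move=> cv; rewrite /pairing /Rintegral fineK//.
by apply: integrable_fin_num; [exact: measurable_gasket|exact: mul_Lu_integrable].
Qed.

Lemma pairing_linear c v w : {within SG, continuous v} ->
  {within SG, continuous w} ->
  pairing (fun x => c * v x + w x) = c * pairing v + pairing w.
Proof.
move=> cv cw; rewrite /pairing.
have iv := mul_Lu_integrable cv; have iw := mul_Lu_integrable cw.
have mS := measurable_gasket.
rewrite -RintegralZl// -RintegralD//.
  by apply: eq_Rintegral => x _; ring.
rewrite (_ : EFin \o _ = EFin \o (fun x : borelPlane R => (c * v x) * Lu x)).
  apply: mul_Lu_integrable => x.
  by apply: cvgM; [exact: cvg_cst|exact: cv].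
by apply/funext => x /=; rewrite mulrA.
Qed.

(** The functional N of the header. *)
Definition boundary_form v : R := energyR q r u v + pairing v.

Let du : dom_energy q SG r u. Proof. by case: hu. Qed.

Lemma boundary_form_linear c v w : dom_energy q SG r v -> dom_energy q SG r w ->
  boundary_form (fun x => c * v x + w x) = c * boundary_form v + boundary_form w.
Proof.
move=> dv dw; case: (dv) (dw) => cv _ [cw _].
by rewrite /boundary_form pairing_linear// (energyR_linear hq hSG hr)//; ring.
Qed.

Lemma boundary_form_eq0 v : dom_energy q SG r v -> (forall i, v (q i) = 0) ->
  boundary_form v = 0.
Proof.
move=> dv v0; case: hu => _ _ /(_ _ dv v0); rewrite (energyE hq hSG hr)//.
case: dv => cv _; rewrite pairingE// => -[].
by rewrite /boundary_form => <-; rewrite subrr.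
Qed.

(** The spike lies between 0 and 1 and vanishes off a cell of measure [mu0 r ^+ m], while [Lu] is
    bounded on [SG]. *)
Lemma pairing_spike_cvg i : pairing (spike q SG r i m) @[m --> \oo] --> (0 : R).
Proof.
have [M hM] : exists M, forall x, SG x -> `|Lu x| <= M.
  case: hu => _ cL _.
  have [M [Mr hM]] := compact_bounded (continuous_compact cL compact_gasket).
  (* [compact_bounded] gives a bound only for numbers strictly above [M]. *)
  exists (M + 1) => x sx; apply: (hM (M + 1)); first by rewrite ltrDl.
  by exists x.
have mS := measurable_gasket.
have bound m : `|pairing (spike q SG r i m)| <= M * mu0 r ^+ m.
  have cs := small_osc_continuous hSG (small_osc_spike hq hSG hr i m).
  have ii := mul_Lu_integrable cs.
  apply: le_trans (le_normr_Rintegral mS ii) _.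
  have Rc : \int[mu]_(x in (SG : set (borelPlane R))) \1_(cell i m) x = mu0 r ^+ m.
    rewrite /Rintegral integral_indic//; last exact: measurable_cell.
    by rewrite setIidl; [exact: (congr1 fine (mu_cell i m))|exact: cell_sub].
  have ic : mu.-integrable (SG : set (borelPlane R)) (EFin \o \1_(cell i m)).
    apply: (@integrableS _ _ _ mu setT) => //.
    by apply: integrable_indic; exact: measurable_cell.
  rewrite -Rc -RintegralZl//; apply: le_Rintegral => //.
  - exact: integrable_norm.
  - rewrite (_ : EFin \o _ = (fun x => M%:E * (EFin \o \1_(cell i m)) x)%E)//.
    exact: integrableZl.
  move=> x sx; rewrite normrM; have [xc|xc] := pselect (cell i m x).
    rewrite indicE mem_set// mulr1 -[leRHS]mul1r ler_pM//; last exact: hM.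
    have /andP[? ?] := spike_bounds q SG hr i m x.
    by rewrite ger0_norm.
  rewrite spike_support// normr0 mul0r mulr_ge0//.
  exact: le_trans (hM _ sx).
have [m0 m1] := andP mu0_bounds.
have c : M * mu0 r ^+ m @[m --> \oo] --> M * (0 : R).
  apply: cvgM; first exact: cvg_cst.
  by apply: cvg_expr; rewrite ger0_norm ?ltW.
rewrite mulr0 in c; apply/norm_cvg0P.
apply: (squeeze_cvgr _ (cvg_cst 0) c).
by apply: nearW => m; rewrite normr_ge0 bound.
Qed.

Lemma cvg_normal_diff i :
  normal_diff q r u i m @[m --> \oo] --> boundary_form (spike q SG r i 0).
Proof.
have E m : normal_diff q r u i m =
    boundary_form (spike q SG r i 0) - pairing (spike q SG r i m).
  rewrite -(energyR_spike hq hSG hr u i m).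
  have ds k := dom_energy_spike hq hSG hr i k.
  (* The spikes of levels [m] and 0 agree on V_0, so [boundary_form] takes the same value on
     both. *)
  have := boundary_form_linear (-1) (ds m) (ds 0%N).
  rewrite boundary_form_eq0.
  - by rewrite /boundary_form; lra.
  - exact: (dom_energy_linear hq hSG hr).
  - by move=> j; rewrite !spike_vertex//; ring.
under eq_fun do rewrite E.
have c : boundary_form (spike q SG r i 0) - pairing (spike q SG r i m)
    @[m --> \oo] --> boundary_form (spike q SG r i 0) - 0.
  by apply: cvgB; [exact: cvg_cst|exact: pairing_spike_cvg].
by rewrite subr0 in c.
Qed.

Lemma boundary_formE v : dom_energy q SG r v ->
  boundary_form v = \sum_i v (q i) * boundary_form (spike q SG r i 0).
Proof.
move=> dv; have ds i := dom_energy_spike hq hSG hr i 0.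
(* Removing the three boundary values one at a time leaves [w2], which vanishes on V_0. *)
pose w0 x := - v (q 0) * spike q SG r 0 0 x + v x.
pose w1 x := - v (q 1) * spike q SG r 1 0 x + w0 x.
pose w2 x := - v (q 2%:R) * spike q SG r 2%:R 0 x + w1 x.
have d0 : dom_energy q SG r w0 by exact: (dom_energy_linear hq hSG hr).
have d1 : dom_energy q SG r w1 by exact: (dom_energy_linear hq hSG hr).
have d2 : dom_energy q SG r w2 by exact: (dom_energy_linear hq hSG hr).
have : boundary_form w2 = 0.
  apply: boundary_form_eq0 => // i; rewrite /w2 /w1 /w0 !(spike_vertex hq hSG hr).
  by case: (ord3P i) => ->; rewrite ?eqxx ?ord3E /=; ring.
rewrite big_ord3 !boundary_form_linear//.
by lra.
Qed.

End GaussGreen.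

Theorem theorem1p1 (R : realType) (q : 'I_3 -> plane R) (SG : set (plane R))
  (r : R) (mu : probability (borelPlane R) R)
  (hq : is_triangle q) (hSG : is_gasket q SG) (hr : 0 < r)
  (hmu : is_self_similar_measure q SG r mu)
  (u Lu : plane R -> R) (hu : is_laplacian q SG r mu u Lu) :
  (forall i : 'I_3, cvgn (normal_diff q r u i)) /\
  (forall v : plane R -> R, dom_energy q SG r v ->
    energy q r u v =
      (- (\int[mu]_(x in SG) (Lu x * v x)%:E)
       + (\sum_(i < 3) v (q i) * normal_derivative q r u i)%:E)%E).
Proof.
have cvgd i := cvg_normal_diff hq hSG hr hmu hu (i := i).
split=> [i|v dv]; first by apply/cvg_ex; eexists; exact: cvgd.
have [du _ _] := hu; have cv := dv.1.
(* Each normal derivative is the [boundary_form] of a spike of level 0, so the boundary sum is the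
   expansion [boundary_formE]. *)
have -> : \sum_(i < 3) v (q i) * normal_derivative q r u i =
    boundary_form q SG r mu u Lu v.
  rewrite (boundary_formE hq hSG hr hu dv); apply: eq_bigr => i _.
  by congr (_ * _); apply: cvg_lim (cvgd i); exact: Rhausdorff.
have -> : (\int[mu]_(x in SG) (Lu x * v x)%:E = (pairing SG mu Lu v)%:E)%E.
  by rewrite -(pairingE hSG hu)//; apply: eq_integral => x _; rewrite mulrC.
rewrite (energyE hq hSG hr)// -EFinN -EFinD; congr EFin.
by rewrite /boundary_form; ring.
Qed.
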